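(* Let $G$ be a finite $2$-group with $d(G)=3$, $\Phi(G)\le Z(G)$, $G'\cong C_2^3$ and $G/G'$ of type $(2^m,2^m,2^m)$ with $m\ge2$, and suppose $G$ is determined by one of the characteristic matrices (P1)–(P4), (Q1)–(Q5), (R1)–(R3) listed in the context. (1) If $I_{\min}=m$, then the characteristic matrix is one of: (P1)–(P4), (Q1)–(Q5). (2) If $I_{\min}=m+1$, then the characteristic matrix is one of: (R1)–(R2). (3) If $I_{\min}=m+2$, then the characteristic matrix is (R3). (4) If $I_{\max}=m+2$, then the characteristic matrix is one of: (Q1)–(Q2), (Q5), (R1)–(R3). (5) If $I_{\max}=m+1$, then the characteristic matrix is one of: (P1)–(P4), (Q3)–(Q4).
   Context: $d(G)$ is the minimal number of generators, $\Phi(G)$ the Frattini subgroup, $G'$ the derived subgroup, $C_2^3$ elementary abelian of order $8$, $F_2$ the field with $2$ elements. An $\mathcal{A}_1$-group is a minimal non-abelian group (non-abelian with all proper subgroups abelian). $2^{I_{\min}}$ and $2^{I_{\max}}$ denote respectively the minimal and the maximal index in $G$ of $\mathcal{A}_1$-subgroups of $G$. Characteristic matrix: let $G/G'$ have type $(2^{m_1},2^{m_2},2^{m_3})$, $m_1\ge m_2\ge m_3\ge1$ (i.e. $G/G'\cong C_{2^{m_1}}\times C_{2^{m_2}}\times C_{2^{m_3}}$). Choose $a_1,a_2,a_3\in G$ with $G/G'=\langle a_1G'\rangle\times\langle a_2G'\rangle\times\langle a_3G'\rangle$, $o(a_iG')=2^{m_i}$; put $x=[a_2,a_3]$, $y=[a_3,a_1]$,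 $z=[a_1,a_2]$, so $G'=\langle x,y,z\rangle$, and write $a_i^{2^{m_i}}=x^{w_{i1}}y^{w_{i2}}z^{w_{i3}}$. The matrix $w(G)=(w_{ij})$ over $F_2$ is called a characteristic matrix of $G$; together with $m_1,m_2,m_3$ it determines $G$ up to isomorphism. Let $e_{ij}$ be the $3\times3$ matrix over $F_2$ with $1$ at $(i,j)$ and $0$ elsewhere. The list is: (P1) $e_{11}+e_{22}+e_{33}$; (P2) $e_{11}+e_{22}+e_{32}+e_{33}$; (P3) $e_{11}+e_{12}+e_{13}+e_{22}+e_{33}$; (P4) $e_{11}+e_{13}+e_{23}+e_{32}$; (Q1) $e_{11}+e_{22}$; (Q2) $e_{12}+e_{21}$; (Q3) $e_{11}+e_{21}+e_{22}$; (Q4) $e_{13}+e_{22}$; (Q5) $e_{12}+e_{23}$; (R1) $e_{12}$; (R2) $e_{11}$; (R3) $0$. *)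

(* Defs.v *)
From mathcomp Require Import all_boot all_order all_algebra.
From mathcomp Require Import all_fingroup all_solvable.

Set Implicit Arguments.
Unset Strict Implicit.
Unset Printing Implicit Defensive.

Local Open Scope group_scope.

(* A_1-groups *)
Definition min_nonabelian (gT : finGroupType) (H : {group gT}) : Prop :=
  ~~ abelian H /\ (forall K : {group gT}, K \proper H -> abelian K).

Definition A1_subgroup (gT : finGroupType) (G H : {group gT}) : Prop :=
  H \subset G /\ min_nonabelian H.

(* is_Imin G k : I_min = k, i.e. 2 ^ k is the least index of an A_1-subgroup. *)
Definition is_Imin (gT : finGroupType) (G : {group gT}) (k : nat) : Prop :=
  (exists2 H : {group gT}, A1_subgroup G H & #|G : H| = (2 ^ k)%N)
  /\ (forall H : {group gT}, A1_subgroup G H -> (2 ^ k <= #|G : H|)%N).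

Definition is_Imax (gT : finGroupType) (G : {group gT}) (k : nat) : Prop :=
  (exists2 H : {group gT}, A1_subgroup G H & #|G : H| = (2 ^ k)%N)
  /\ (forall H : {group gT}, A1_subgroup G H -> (#|G : H| <= 2 ^ k)%N).

(* w is the characteristic matrix of G relative to a = (a_1, a_2, a_3), where
   G / G' has type (2 ^ m_1, 2 ^ m_2, 2 ^ m_3); indices are shifted to 0, 1, 2.
   Elements of 'F_2 are ordinals, so w i j also serves as the exponent 0 or 1. *)
Definition char_matrix (gT : finGroupType) (G : {group gT})
    (m : 'I_3 -> nat) (a : 'I_3 -> gT) (w : 'M['F_2]_3) : Prop :=
  let G' := G^`(1) in
  let a1 := a 0%R in let a2 := a 1%R in let a3 := a 2%R in
  let x := [~ a2, a3] in let y := [~ a3, a1] in let z := [~ a1, a2] in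
  [/\ forall i, a i \in G,
      <[coset G' a1]> \x <[coset G' a2]> \x <[coset G' a3]> = G / G',
      forall i, #[coset G' (a i)] = (2 ^ m i)%N
    & forall i, a i ^+ (2 ^ m i)%N
                = x ^+ w i 0%R * y ^+ w i 1%R * z ^+ w i 2%R].

(* The matrix unit e_{ij}, with 1-based indices i, j in {1, 2, 3}. *)
Definition e_ (i j : nat) : 'M['F_2]_3 := delta_mx (inord i.-1) (inord j.-1).

Local Open Scope ring_scope.

Definition mxP1 := e_ 1 1 + e_ 2 2 + e_ 3 3.
Definition mxP2 := e_ 1 1 + e_ 2 2 + e_ 3 2 + e_ 3 3.
Definition mxP3 := e_ 1 1 + e_ 1 2 + e_ 1 3 + e_ 2 2 + e_ 3 3.
Definition mxP4 := e_ 1 1 + e_ 1 3 + e_ 2 3 + e_ 3 2.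
Definition mxQ1 := e_ 1 1 + e_ 2 2.
Definition mxQ2 := e_ 1 2 + e_ 2 1.
Definition mxQ3 := e_ 1 1 + e_ 2 1 + e_ 2 2.
Definition mxQ4 := e_ 1 3 + e_ 2 2.
Definition mxQ5 := e_ 1 2 + e_ 2 3.
Definition mxR1 := e_ 1 2.
Definition mxR2 := e_ 1 1.
Definition mxR3 : 'M['F_2]_3 := 0.

(* Main.v *)
(* G has class 2, so its A_1-subgroups are the H = <b, c> with b, c in G not commuting.  Such b, c
   extend to a generating set of G, whence |HG' / G'| = 2 ^ (2m) and H meets G' in
   S = <[b, c], b ^ (2 ^ m), c ^ (2 ^ m)>; thus |G : H| * |S| = 2 ^ (m + 3).  Let beta, gamma in F_2^3
   be the exponent vectors modulo 2 of b, c in a_1, a_2, a_3.  In the basis x, y, z of G', the element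
   [b, c] is the cross product beta x gamma and, as m >= 2, b ^ (2 ^ m) is the vector beta * w.  So
   the possible orders of S depend only on w, and are found by enumerating the pairs (beta, gamma). *)
Require Import Defs.
From mathcomp Require Import all_boot all_order all_algebra.
From mathcomp Require Import all_fingroup all_solvable.
From mathcomp Require Import ring.
Local Open Scope group_scope.

Set Implicit Arguments.
Unset Strict Implicit.
Unset Printing Implicit Defensive.

(** * Orders of two-generator groups *)

Lemma card_gen2_abelian (gT : finGroupType) (u v : gT) :
  commute u v -> (#|<<[set u; v]>>| <= #[u] * #[v])%N.
Proof.
move=> cuv; have -> : <<[set u; v]>> = <[u]> * <[v]>.
  rewrite -cent_joinEr; first by rewrite joing_idl joing_idr.
  by rewrite cycle_subG; apply/centP => x /cycleP[i ->]; apply/commuteX/commute_sym.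
by rewrite !orderE mul_cardG leq_pmulr.
Qed.

(** The images of [b] and [c] commute and have order at most [n]. This serves with [n = 2] modulo a
    Frattini subgroup, and with [n = 2 ^ m] modulo G' and modulo the group [S] of [index_gen2]. *)
Lemma card_gen2_quotient (gT : finGroupType) (N : {group gT}) (b c : gT) (n : nat) :
  b \in 'N(N) -> c \in 'N(N) -> [~ b, c] \in N -> b ^+ n \in N -> c ^+ n \in N ->
  (0 < n)%N -> (#|<<[set b; c]>> / N| <= n * n)%N.
Proof.
move=> nb nc Nbc Nb Nc n0.
have sbN : [set b; c] \subset 'N(N) by rewrite subUset !sub1set nb.
rewrite quotient_gen // quotientE morphimU !morphim_set1 //.
have o x : x \in 'N(N) -> x ^+ n \in N -> (#[coset N x] <= n)%N.
  by move=> nx Nx; rewrite dvdn_leq // order_dvdn -morphX //; apply/eqP/coset_id.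
apply: leq_trans (card_gen2_abelian _) (leq_mul (o _ nb Nb) (o _ nc Nc)).
by apply/commgP/eqP; rewrite -morphR //; apply: coset_id.
Qed.

(** * Minimal non-abelian subgroups and their indices when the Frattini subgroup is central *)

Section Class2.
Context {gT : finGroupType} {G : {group gT}}.
Hypothesis G_2group : 2.-group G.
Hypothesis Phi_central : 'Phi(G) \subset 'Z(G).

(** In a 2-group, 'Phi(H) lies in 'Phi(G), so it is central, and a group that is cyclic modulo a
    central subgroup is abelian. *)
Lemma cyclic_mod_Phi_abelian (H K : {group gT}) :
  K \subset H -> H \subset G -> cyclic (K <*> 'Phi(H) / 'Phi(H)) -> abelian K.
Proof.
move=> sKH sHG cyc.
have sKPG : K <*> 'Phi(H) \subset G by rewrite join_subG (subset_trans sKH) // (subset_trans (Phi_sub H)).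
have sPZ : 'Phi(H) \subset 'Z(K <*> 'Phi(H)).
  rewrite subsetI joing_subr centsC (subset_trans sKPG) // centsC.
  apply: subset_trans (PhiS G_2group sHG) _.
  by apply: subset_trans Phi_central _; rewrite subIset // subxx orbT.
exact: abelianS (joing_subl K 'Phi(H)) (cyclic_factor_abelian sPZ cyc).
Qed.

(** Let H be generated by [b] and [c]. The quotient of H by its Frattini subgroup has order at most
    4. A proper subgroup stays proper after joining 'Phi(H), so its image has order at most 2 and is
    cyclic; [cyclic_mod_Phi_abelian] then applies. *)
Lemma gen2_min_nonabelian (b c : gT) :
  b \in G -> c \in G -> [~ b, c] != 1 -> min_nonabelian <<[set b; c]>>%G.
Proof.
move=> bG cG ncbc; set H := <<_>>%G.
have bH : b \in H by rewrite mem_gen // !inE eqxx.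
have cH : c \in H by rewrite mem_gen // !inE eqxx orbT.
have sHG : H \subset G by rewrite gen_subG; apply/subsetP => x; rewrite !inE => /orP[]/eqP->.
have H_2group : 2.-group H := pgroupS sHG G_2group.
split.
  apply: contra ncbc => /centsP/(_ b bH c cH) cbc; exact/commgP.
move=> K ltKH; have sKH := proper_sub ltKH.
apply: (cyclic_mod_Phi_abelian sKH sHG).
have nPH := normal_norm (Phi_normal H).
have abH := Phi_quotient_abelem H_2group.
have sKPH : K <*> 'Phi(H) \subset H by rewrite join_subG sKH Phi_sub.
have ltq : K <*> 'Phi(H) / 'Phi(H) \proper H / 'Phi(H).
  rewrite quotient_proper ?(normalS (joing_subr _ _) sKPH) ?Phi_normal //.
  rewrite properE sKPH; apply: contraL ltKH => sHK.
  rewrite properE sKH negbK -[K : {set _}]genGid.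
  by rewrite (@Phi_nongen _ H K) //; apply/eqP; rewrite eqEsubset joingC sKPH.
rewrite (abelem_cyclic (abelemS (proper_sub ltq) abH)).
have sq x : x \in H -> x ^+ 2 \in 'Phi(H).
  move=> xH; apply: coset_idr; first by rewrite groupX ?(subsetP nPH).
  by case/abelemP: abH => // _ ex; rewrite morphX ?(subsetP nPH) // ex ?mem_quotient.
have sH'P : H^`(1) \subset 'Phi(H) by rewrite (Phi_joing H_2group) joing_subl.
have H4 : (#|H / 'Phi(H)| <= 2 * 2)%N.
  apply: card_gen2_quotient; rewrite ?(subsetP nPH) ?sq //.
  exact: (subsetP sH'P _ (mem_commg bH cH)).
have K2 := pgroupS (proper_sub ltq) (abelem_pgroup abH).
have := leq_trans (proper_card ltq) H4.
by rewrite (card_pgroup K2); case: logn => [|[|n]] //; rewrite (ltn_exp2l n.+2 2).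
Qed.

(** Any two non-commuting elements will do: they generate a non-abelian subgroup, which by
    minimality cannot be proper. *)
Lemma A1_gen2 (H : {group gT}) : min_nonabelian H ->
  exists b c, [/\ b \in H, c \in H, [~ b, c] != 1 & H = <<[set b; c]>>%G].
Proof.
move=> [nab minH].
have [b bH] := subsetPn nab; rewrite -sub_cent1 => /subsetPn[c cH ncb].
have nbc : [~ b, c] != 1 by apply: contra ncb => /commgP/cent1P; rewrite cent1C.
exists b, c; split=> //; apply/val_inj/eqP => /=.
rewrite eq_sym eqEproper gen_subG subUset !sub1set bH cH /=.
apply: contra nbc => /(minH <<[set b; c]>>%G) /centsP cab.
by apply/commgP/cab; rewrite mem_gen // !inE eqxx ?orbT.
Qed.

Hypothesis G_gen3 : 'm(G) = 3.

(** Modulo 'Phi(G) the group has order at most 8, while the image of the group generated by [b] and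
    [c] is not cyclic and so has order at least 4. One further element is therefore enough. *)
Lemma noncomm_extend_gen (b c : gT) :
  b \in G -> c \in G -> [~ b, c] != 1 -> exists2 d, d \in G & <<c |: [set b; d]>> = G.
Proof.
move=> bG cG ncbc; set F := 'Phi(G).
have nFG := normal_norm (Phi_normal G).
have abF := Phi_quotient_abelem G_2group.
have sHG : <<[set b; c]>> \subset G by rewrite gen_subG subUset !sub1set bG.
pose M := <<[set b; c]>> <*> F.
have sMG : M \subset G by rewrite join_subG sHG Phi_sub.
have sFM : F \subset M by rewrite joing_subr.
have lM : (2 <= logn 2 #|M / F|)%N.
  rewrite ltnNge -(abelem_cyclic (abelemS (quotientS _ sMG) abF)).
  apply: contra ncbc => /(cyclic_mod_Phi_abelian sHG (subxx _)) /centsP cab.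
  by apply/commgP/cab; rewrite mem_gen // !inE eqxx ?orbT.
have lG : (logn 2 #|G / F| <= 3)%N.
  by rewrite -rank_abelem // -grank_abelian ?(abelem_abelian abF) // -G_gen3 quotient_grank.
have cG8 : (#|G : F| <= 8)%N.
  by rewrite -card_quotient // (card_pgroup (abelem_pgroup abF)); exact: (@leq_pexp2l 2 _ 3).
have cM4 : (4 <= #|M : F|)%N.
  rewrite -card_quotient ?(subset_trans sMG) //.
  rewrite (card_pgroup (pgroupS (quotientS _ sMG) (abelem_pgroup abF))).
  exact: (@leq_pexp2l 2 2).
(* A group strictly above [M] has index at least 2 * 4 over [F], which already exhausts G. *)
have big (N : {group gT}) : M \proper N -> N \subset G -> N = G.
  move=> ltMN sNG; apply/eqP; rewrite -val_eqE eqEcard sNG /=.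
  have := Lagrange (Phi_sub G); rewrite -/F => <-.
  rewrite -(Lagrange (proper_sub ltMN)) -(Lagrange sFM) -mulnA leq_mul2l.
  apply/orP; right; apply: leq_trans cG8 _.
  by apply: (@leq_mul 4 2) => //; rewrite indexg_gt1 proper_subn.
have [sGM | nsGM] := boolP (G \subset M).
  (* Here [b] and [c] generate G modulo [F], so any third element serves. *)
  exists b => //; apply: Phi_nongen; apply/eqP.
  rewrite eqEsubset join_subG Phi_sub !subUset !sub1set bG cG /=.
  apply: subset_trans sGM _; rewrite join_subG joing_subl andbT gen_subG.
  by rewrite subUset !sub1set; apply/andP; split; apply: (subsetP (joing_subr _ _)); rewrite !inE eqxx ?orbT.
have [d dG ndM] := subsetPn nsGM; exists d => //.
apply: Phi_nongen.
have sM : M \subset F <*> <<c |: [set b; d]>>.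
  rewrite join_subG joing_subl andbT gen_subG.
  by rewrite subUset !sub1set; apply/andP; split; apply: (subsetP (joing_subr _ _)); rewrite mem_gen // !inE eqxx ?orbT.
rewrite -joing_idr.
apply: (congr1 (@gval gT) (big (F <*> <<c |: [set b; d]>>)%G _ _)).
  rewrite properE sM /=; apply: contra ndM => /subsetP; apply.
  by apply: (subsetP (joing_subr _ _)); rewrite mem_gen // !inE eqxx ?orbT.
by rewrite join_subG Phi_sub gen_subG !subUset !sub1set bG cG dG.
Qed.

Variable m : nat.
Hypothesis G'_exp : forall g, g \in G -> g ^+ (2 ^ m) \in G^`(1).
Hypothesis card_GG' : #|G / G^`(1)| = (2 ^ (3 * m))%N.

(** For the lower bound, a third generator [d] contributes a factor of at most [2 ^ m] to the order
    [2 ^ (3 * m)] of G / G'. *)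
Lemma card_gen2_mod_der (b c : gT) : b \in G -> c \in G -> [~ b, c] != 1 ->
  #|<<[set b; c]>> / G^`(1)| = (2 ^ m * 2 ^ m)%N.
Proof.
move=> bG cG ncbc; have nG'G := normal_norm (der_normal 1 G).
have m0 : (0 < 2 ^ m)%N by rewrite expn_gt0.
apply/eqP; rewrite eqn_leq card_gen2_quotient ?(subsetP nG'G) ?G'_exp ?mem_commg //=.
have [d dG defG] := noncomm_extend_gen bG cG ncbc.
have sHG : <<[set b; c]>> \subset G by rewrite gen_subG subUset !sub1set bG.
have cG' : abelian (G / G^`(1)) := sub_der1_abelian (subxx _).
have : (#|G / G^`(1)| <= #|<<[set b; c]>> / G^`(1)| * 2 ^ m)%N.
  apply: (@leq_trans (#|<<[set b; c]>> / G^`(1)| * #[coset G^`(1) d])).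
    have -> : G / G^`(1) = (<<[set b; c]>> / G^`(1)) * <[coset G^`(1) d]>.
      rewrite -quotient_cycle ?(subsetP nG'G) // -cent_joinEr; last first.
        by apply: subset_trans (quotientS _ _) (subset_trans cG' (centS (quotientS _ sHG))); rewrite cycle_subG.
      rewrite -quotientY ?cycle_subG ?(subsetP nG'G) ?(subset_trans sHG) //.
      rewrite joing_idl joing_idr; apply: (congr1 (fun A : {set gT} => A / G^`(1))).
      rewrite -[LHS]defG.
      by rewrite joingE -setUA setUCA.
    by rewrite orderE mul_cardG leq_pmulr.
  by rewrite leq_mul2l dvdn_leq ?orbT // order_dvdn -morphX ?(subsetP nG'G) //; apply/eqP/coset_id/G'_exp.
rewrite card_GG' !mulSn mul0n addn0 !expnD mulnA leq_mul2r expn_eq0 //=.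
Qed.

Hypothesis G'_card : #|G^`(1)| = 8.

(** The index of [S] in [H] is squeezed to [2 ^ m * 2 ^ m]. It is at most this because [b] and [c]
    commute modulo the central [S] and have their [2 ^ m]-th powers in it. It is at least this
    because [S] lies in the intersection of [H] with G', whose index in [H] is given by
    [card_gen2_mod_der]. *)
Lemma index_gen2 (b c : gT) : b \in G -> c \in G -> [~ b, c] != 1 ->
  (#|G : <<[set b; c]>>| * #|<<[set [~ b, c]; b ^+ (2 ^ m); c ^+ (2 ^ m)]>>| = 2 ^ (m + 3))%N.
Proof.
move=> bG cG ncbc; pose H := <<[set b; c]>>%G.
pose S := <<[set [~ b, c]; b ^+ (2 ^ m); c ^+ (2 ^ m)]>>%G.
change (#|G : H| * #|S| = 2 ^ (m + 3))%N.
have m0 : (0 < 2 ^ m)%N by rewrite expn_gt0.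
have nG'G := normal_norm (der_normal 1 G).
have bH : b \in H by rewrite mem_gen // !inE eqxx.
have cH : c \in H by rewrite mem_gen // !inE eqxx orbT.
have sHG : H \subset G by rewrite gen_subG subUset !sub1set bG.
have sSHG' : S \subset H :&: G^`(1).
  rewrite gen_subG !subUset !sub1set; do !(apply/andP; split); rewrite in_setI.
  - by rewrite groupR // mem_commg.
  - by rewrite groupX // G'_exp.
  - by rewrite groupX // G'_exp.
have [sSH sSG'] := subsetIP sSHG'.
have sSZ : S \subset 'Z(G).
  apply: subset_trans sSG' (subset_trans _ Phi_central).
  by rewrite (Phi_joing G_2group) joing_subl.
have nSG : G \subset 'N(S) by apply/cents_norm; rewrite centsC (subset_trans sSZ) ?subsetIr.
have [S1 [S2 S3]] : [~ b, c] \in S /\ b ^+ (2 ^ m) \in S /\ c ^+ (2 ^ m) \in S.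
  by rewrite !mem_gen // !inE eqxx ?orbT.
have cardH : #|H| = (#|S| * (2 ^ m * 2 ^ m))%N.
  apply/eqP; rewrite eqn_leq; apply/andP; split.
    rewrite -(Lagrange sSH) leq_mul2l -card_quotient ?(subset_trans sHG) //.
    by rewrite card_gen2_quotient ?(subsetP nSG) ?orbT.
  rewrite -(card_gen2_mod_der bG cG ncbc) card_quotient ?(subset_trans sHG) //.
  by rewrite -(LagrangeI H G^`(1)) leq_mul2r subset_leq_card ?orbT.
have := Lagrange (der_sub 1 G); rewrite -card_quotient // card_GG' G'_card.
rewrite -(Lagrange sHG) cardH => e.
apply/eqP; rewrite -(eqn_pmul2r (_ : 0 < 2 ^ m * 2 ^ m)%N) ?muln_gt0 ?m0 //.
by rewrite -mulnA mulnC -{}e !mulSn mul0n addn0 !expnD; apply/eqP; ring.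
Qed.

End Class2.

(** * Exponents modulo 2, and linear algebra on boolean triples *)

Lemma commute_mulACA (gT : finGroupType) (p q r s : gT) :
  commute q r -> p * q * (r * s) = p * r * (q * s).
Proof. by move=> cqr; rewrite -!mulgA (mulgA q) cqr -mulgA. Qed.

Lemma expg2_odd (gT : finGroupType) (x : gT) (n : nat) :
  x ^+ 2 = 1 -> x ^+ n = x ^+ odd n.
Proof. by move=> x2; rewrite -modn2 expg_mod. Qed.

(* F_2^3 over bool rather than 'F_2, so that the final enumeration computes. *)
Notation vec3 := (bool * bool * bool)%type.

Definition vec3_add (u v : vec3) : vec3 :=
  let: (u1, u2, u3) := u in let: (v1, v2, v3) := v in
  (u1 (+) v1, u2 (+) v2, u3 (+) v3).

Definition vec3_scale (e : bool) (u : vec3) : vec3 :=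
  if e then u else (false, false, false).

Definition vec3_cross (u v : vec3) : vec3 :=
  let: (u1, u2, u3) := u in let: (v1, v2, v3) := v in
  ((u2 && v3) (+) (u3 && v2), (u3 && v1) (+) (u1 && v3), (u1 && v2) (+) (u2 && v1)).

(** The row vector [e] times the matrix with rows [u], [v], [t]; it yields both the power map and
    the elements of a span. *)
Definition vec3_comb (u v t e : vec3) : vec3 :=
  let: (e1, e2, e3) := e in
  vec3_add (vec3_add (vec3_scale e1 u) (vec3_scale e2 v)) (vec3_scale e3 t).

Definition all_vec3 : seq vec3 :=
  [seq (p, r) | p <- [seq (p, q) | p <- [:: true; false], q <- [:: true; false]],
                r <- [:: true; false]].

Lemma mem_all_vec3 (u : vec3) : u \in all_vec3.
Proof. by case: u => [[[] []] []]. Qed.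

Definition vec3_span (u v t : vec3) : seq vec3 := [seq vec3_comb u v t e | e <- all_vec3].

Lemma vec3_combD (u v t e f : vec3) :
  vec3_add (vec3_comb u v t e) (vec3_comb u v t f) = vec3_comb u v t (vec3_add e f).
Proof.
have E (c : bool) (p : vec3) : vec3_scale c p = (c && p.1.1, c && p.1.2, c && p.2).
  by case: c p => [] [[]].
case: e f => [[e1 e2] e3] [[f1 f2] f3]; rewrite /= !E /=.
(* Treating one coordinate at a time keeps the truth table at 9 booleans instead of 15. *)
have D p q r : (e1 && p (+) e2 && q (+) e3 && r) (+) (f1 && p (+) f2 && q (+) f3 && r)
    = (e1 (+) f1) && p (+) (e2 (+) f2) && q (+) (e3 (+) f3) && r.
  by case: e1 e2 e3 f1 f2 f3 p q r => [] [] [] [] [] [] [] [] [].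
by rewrite !D.
Qed.

(** The order of the group [S] of [index_gen2] for generators with exponent vectors [u] and [v], as
    [card_gen2_order] shows. [undup] is there because a span lists dependent combinations
    repeatedly. *)
Definition gen2_order (W : vec3 * vec3 * vec3) (u v : vec3) : nat :=
  let: (w1, w2, w3) := W in
  size (undup (vec3_span (vec3_cross u v) (vec3_comb w1 w2 w3 u) (vec3_comb w1 w2 w3 v))).

(** A nonzero cross product encodes that the generators do not commute. Sorting without repetition
    gives each matrix one explicit list to compute. *)
Definition gen2_orders (W : vec3 * vec3 * vec3) : seq nat :=
  sort leq (undup [seq gen2_order W p.1 p.2
    | p <- [seq (u, v) | u <- all_vec3, v <- all_vec3]
    & vec3_cross p.1 p.2 != (false, false, false)]).

Lemma gen2_ordersP (W : vec3 * vec3 * vec3) (r : nat) :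
  reflect (exists u v, vec3_cross u v != (false, false, false) /\ r = gen2_order W u v)
    (r \in gen2_orders W).
Proof.
rewrite mem_sort mem_undup; apply: (iffP mapP) => [[[u v] + ->]|[u [v [uv ->]]]].
  by rewrite mem_filter => /andP[uv _]; exists u, v.
by exists (u, v); rewrite // mem_filter uv allpairs_f ?mem_all_vec3.
Qed.

(** * Commutators and [2 ^ m]-th powers in coordinates *)

Section Coordinates.
Context {gT : finGroupType} {G : {group gT}} (a1 a2 a3 : gT) (m : nat).
Hypothesis cG' : G^`(1) \subset 'Z(G).
Hypothesis abG' : 2.-abelem G^`(1).
Hypothesis G'_card : #|G^`(1)| = 8.
Hypothesis m_ge2 : (2 <= m)%N.
Hypotheses (a1G : a1 \in G) (a2G : a2 \in G) (a3G : a3 \in G).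
Hypothesis a_gen : forall g, g \in G ->
  exists i j k h, h \in G^`(1) /\ g = a1 ^+ i * a2 ^+ j * a3 ^+ k * h.

Local Notation x := [~ a2, a3].
Local Notation y := [~ a3, a1].
Local Notation z := [~ a1, a2].

Definition der_vec (u : vec3) : gT :=
  let: (p, q, r) := u in x ^+ p * y ^+ q * z ^+ r.

Variables w1 w2 w3 : vec3.
Hypotheses (a1_pow : a1 ^+ (2 ^ m) = der_vec w1) (a2_pow : a2 ^+ (2 ^ m) = der_vec w2)
  (a3_pow : a3 ^+ (2 ^ m) = der_vec w3).

(** A relation, so that the exponents may be any naturals; only their parities affect commutators
    and [2 ^ m]-th powers. *)
Definition has_coord (g : gT) (u : vec3) : Prop := exists i j k h,
  [/\ h \in G^`(1), g = a1 ^+ i * a2 ^+ j * a3 ^+ k * h & u = (odd i, odd j, odd k)].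

Lemma der_central g h : g \in G^`(1) -> h \in G -> commute g h.
Proof. by move=> /(subsetP cG') /centerP[_ +] hG => /(_ h hG). Qed.

Lemma der_sq h : h \in G^`(1) -> h ^+ 2 = 1.
Proof. by case/abelemP: abG' => // _; apply. Qed.

Lemma commMl (f g h : gT) : f \in G -> g \in G -> h \in G ->
  [~ f * g, h] = [~ f, h] * [~ g, h].
Proof.
move=> fG gG hG; rewrite commMgJ conjgE.
by rewrite (der_central (mem_commg fG hG) gG) mulKg.
Qed.

Lemma commXl (f g : gT) i : f \in G -> g \in G -> [~ f ^+ i, g] = [~ f, g] ^+ i.
Proof. by move=> fG gG; apply: commXg; apply/commute_sym/der_central => //; apply: mem_commg. Qed.

Lemma comm_sym (f g : gT) : f \in G -> g \in G -> [~ f, g] = [~ g, f].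
Proof.
move=> fG gG; rewrite -invg_comm; apply/eqP; rewrite eq_invg_mul -expg2.
by apply/eqP/der_sq/mem_commg.
Qed.

Lemma xG' : x \in G^`(1). Proof. exact: mem_commg. Qed.
Lemma yG' : y \in G^`(1). Proof. exact: mem_commg. Qed.
Lemma zG' : z \in G^`(1). Proof. exact: mem_commg. Qed.

Lemma der_vec_der u : der_vec u \in G^`(1).
Proof. by case: u => [[p q] r]; rewrite !groupM ?groupX ?xG' ?yG' ?zG'. Qed.

Lemma der_vecM u v : der_vec u * der_vec v = der_vec (vec3_add u v).
Proof.
case: u v => [[p q] r] [[p' q'] r'] /=.
have cc g h : g \in G^`(1) -> h \in G^`(1) -> commute g h.
  by move=> gG' hG'; apply: der_central => //; apply: (subsetP (der_sub 1 G)).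
have D t (e e' : bool) : t \in G^`(1) -> t ^+ e * t ^+ e' = t ^+ (e (+) e').
  by move=> /der_sq; case: e e' => [] [] //=; rewrite ?mulg1 ?mul1g.
rewrite commute_mulACA; last by apply: cc; rewrite ?groupM ?groupX ?xG' ?yG' ?zG'.
rewrite [x ^+ p * _ * _]commute_mulACA; last by apply: cc; rewrite ?groupX ?xG' ?yG'.
by rewrite !D ?xG' ?yG' ?zG'.
Qed.

Lemma der_vec0 : der_vec (false, false, false) = 1.
Proof. by rewrite /= !mulg1. Qed.

Lemma der_vecX u i : der_vec u ^+ i = der_vec (vec3_scale (odd i) u).
Proof.
rewrite (expg2_odd i (der_sq (der_vec_der u))); case: (odd i) => //=.
by rewrite !mulg1.
Qed.

(** Commutators are bilinear because G' is central, and signs vanish because G' has exponent 2. *)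
Lemma comm_vec g h u v : has_coord g u -> has_coord h v ->
  [~ g, h] = der_vec (vec3_cross u v).
Proof.
case=> i [j [k [g' [g'G' -> ->]]]] [i' [j' [k' [h' [h'G' -> ->]]]]].
have sG'G := subsetP (der_sub 1 G).
have lin f i0 j0 k0 f' : f \in G -> f' \in G^`(1) ->
    [~ a1 ^+ i0 * a2 ^+ j0 * a3 ^+ k0 * f', f] = [~ a1, f] ^+ i0 * [~ a2, f] ^+ j0 * [~ a3, f] ^+ k0.
  move=> fG f'G'; have f'G := sG'G _ f'G'.
  rewrite !commMl ?groupM ?groupX // !commXl //.
  by have /commgP/eqP-> := der_central f'G' fG; rewrite mulg1.
have hG : a1 ^+ i' * a2 ^+ j' * a3 ^+ k' * h' \in G by have h'G := sG'G _ h'G'; rewrite !groupM ?groupX.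
have X : x = der_vec (true, false, false) by rewrite /= !mulg1.
have Y : y = der_vec (false, true, false) by rewrite /= mulg1 mul1g.
have Z : z = der_vec (false, false, true) by rewrite /= !mul1g.
(* [lin] expands the first argument; symmetry then brings the second one into that place. *)
rewrite lin // ![[~ _, _ * h']]comm_sym // !lin // !commgg.
rewrite (comm_sym a2G a1G) (comm_sym a1G a3G) (comm_sym a3G a2G) X Y Z -der_vec0.
rewrite !(der_vecX, der_vecM) /=.
by case: (odd i) (odd j) (odd k) (odd i') (odd j') (odd k') => [] [] [] [] [] [].
Qed.

(** In class 2 the correction term is a commutator to the power ['C(2 ^ m, 2)], which is even once m
    is at least 2. *)
Lemma expM_pow2 (f g : gT) : f \in G -> g \in G ->
  (f * g) ^+ (2 ^ m) = f ^+ (2 ^ m) * g ^+ (2 ^ m).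
Proof.
move=> fG gG; have cfg := mem_commg gG fG.
rewrite expMg_Rmul; try by apply/commute_sym/der_central.
have -> : 'C(2 ^ m, 2) = ((2 ^ (m - 2) * (2 ^ m).-1) * 2)%N.
  rewrite bin2 -[RHS]doubleK -muln2; congr (_./2).
  by rewrite -[in X in (X * _)%N](subnK m_ge2) expnD; ring.
by rewrite mulnC expgM der_sq // expg1n mulg1.
Qed.

Lemma pow_vec g u : has_coord g u -> g ^+ (2 ^ m) = der_vec (vec3_comb w1 w2 w3 u).
Proof.
case=> i [j [k [h [hG' -> ->]]]]; have hG := subsetP (der_sub 1 G) _ hG'.
rewrite !expM_pow2 ?groupM ?groupX // -!expgM ![(_ * 2 ^ m)%N]mulnC !expgM.
rewrite a1_pow a2_pow a3_pow !(der_vecX, der_vecM).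
rewrite -(subnK m_ge2) addnC expnD expgM [h ^+ _](expgM h 2 2) (der_sq hG') !expg1n mulg1.
by [].
Qed.

Lemma has_coord_mem g u : has_coord g u -> g \in G.
Proof.
case=> i [j [k [h [hG' -> _]]]].
by rewrite !groupM ?groupX // (subsetP (der_sub 1 G)).
Qed.

Lemma has_coord_ex g : g \in G -> exists u, has_coord g u.
Proof.
move=> /a_gen[i [j [k [h [hG' ->]]]]]; exists (odd i, odd j, odd k).
by exists i, j, k, h.
Qed.

Lemma has_coord_vec (p q r : bool) : has_coord (a1 ^+ p * a2 ^+ q * a3 ^+ r) (p, q, r).
Proof. by exists p, q, r, 1; rewrite group1 mulg1 !oddb. Qed.

Lemma group_set_der_vec (s : seq vec3) :
  (false, false, false) \in s -> {in s &, forall u v, vec3_add u v \in s} ->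
  group_set (der_vec @: [set u in s]).
Proof.
move=> s0 sD; apply/group_setP; split.
  by rewrite -der_vec0 imset_f // inE.
move=> _ _ /imsetP[u us ->] /imsetP[v vs ->].
by rewrite inE in us; rewrite inE in vs; rewrite der_vecM imset_f // inE sD.
Qed.

(** The image is a group containing every commutator, hence all of G'. Eight vectors mapping onto a
    group of order 8 must have distinct images. *)
Lemma der_vec_inj : injective der_vec.
Proof.
have gs : group_set (der_vec @: [set u in all_vec3]).
  by apply: group_set_der_vec => [|u v _ _]; rewrite mem_all_vec3.
have : G^`(1) \subset der_vec @: [set u in all_vec3].
  rewrite -(gen_set_id gs); apply: genS; apply/subsetP=> _ /imset2P[g h gG hG ->].
  have [[u gu] [v hv]] := (has_coord_ex gG, has_coord_ex hG).
  by rewrite (comm_vec gu hv) imset_f // inE mem_all_vec3.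
move/subset_leq_card; rewrite G'_card => le8.
have /imset_injP inj : #|der_vec @: [set u in all_vec3]| == #|[set u in all_vec3]|.
  rewrite eqn_leq leq_imset_card (leq_trans _ le8) //.
  by rewrite (leq_trans (max_card _)) // !card_prod card_bool.
by move=> u v; apply: inj; rewrite inE mem_all_vec3.
Qed.

Lemma comm_neq1 g h u v : has_coord g u -> has_coord h v ->
  ([~ g, h] != 1) = (vec3_cross u v != (false, false, false)).
Proof. by move=> gu hv; rewrite (comm_vec gu hv) -der_vec0 (inj_eq der_vec_inj). Qed.

(** [der_vec] turns addition into multiplication and is injective, so it carries the linear span
    bijectively onto the generated subgroup. *)
Lemma card_gen_der_vec u v t :
  #|<<[set der_vec u; der_vec v; der_vec t]>>| = size (undup (vec3_span u v t)).
Proof.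
set s := vec3_span u v t.
have sP e : vec3_comb u v t e \in s by rewrite map_f ?mem_all_vec3.
have gs : group_set (der_vec @: [set u in s]).
  apply: group_set_der_vec => [|_ _ /mapP[e _ ->] /mapP[f _ ->]].
    exact: (sP (false, false, false)).
  by rewrite vec3_combD.
have -> : <<[set der_vec u; der_vec v; der_vec t]>> = der_vec @: [set u in s].
  apply/eqP; rewrite eqEsubset -{1}(gen_set_id gs) gen_subG; apply/andP; split.
    apply: subset_trans (subset_gen _); rewrite !subUset !sub1set.
    have C1 p q r : vec3_comb p q r (true, false, false) = p by case: p => [[[] []] []].
    have C2 p q r : vec3_comb p q r (false, true, false) = q by case: q => [[[] []] []].
    have C3 p q r : vec3_comb p q r (false, false, true) = r by case: r => [[[] []] []].
    have := sP (true, false, false); rewrite C1 => su.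
    have := sP (false, true, false); rewrite C2 => sv.
    have := sP (false, false, true); rewrite C3 => st.
    by rewrite !imset_f // inE.
  apply/subsetP => _ /imsetP[p + ->]; rewrite inE => /mapP[[[e f] g] _ ->] /=.
  rewrite -!der_vecM -[e]oddb -[f]oddb -[g]oddb -!der_vecX.
  by rewrite !groupM ?groupX ?mem_gen // !inE eqxx ?orbT.
rewrite card_imset; last exact: der_vec_inj.
by rewrite cardsE -(card_uniqP (undup_uniq s)); apply: eq_card => p; rewrite mem_undup.
Qed.

Lemma card_gen2_order g h u v : has_coord g u -> has_coord h v ->
  #|<<[set [~ g, h]; g ^+ (2 ^ m); h ^+ (2 ^ m)]>>| = gen2_order (w1, w2, w3) u v.
Proof. by move=> gu hv; rewrite (comm_vec gu hv) (pow_vec gu) (pow_vec hv) card_gen_der_vec. Qed.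

End Coordinates.

(** * Evaluation of the listed matrices *)

Lemma F2_nat (c : 'F_2) : c = (c != 0%R) :> nat.
Proof. by case: c => [[|[|n]]]. Qed.

Definition mx_vecs (w : 'M['F_2]_3) : vec3 * vec3 * vec3 :=
  let row (i : 'I_3) := (w i 0%R != 0%R, w i 1%R != 0%R, w i 2%R != 0%R) in
  (row 0%R, row 1%R, row 2%R).

(** Replaces [inord] by comparisons of naturals, which [vm_compute] can evaluate in
    [gen2_ordersE]. *)
Lemma mx_unitE (i j : nat) (k l : 'I_3) : (0 < i <= 3)%N -> (0 < j <= 3)%N ->
  e_ i j k l = ((k.+1 == i) && (l.+1 == j))%:R%R.
Proof.
by case: i j => [|i] [|j] // i3 j3; rewrite mxE -!val_eqE /= !inordK.
Qed.

Lemma mx_addE (A B : 'M['F_2]_3) (k l : 'I_3) : (A + B)%R k l = (A k l + B k l)%R.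
Proof. by rewrite mxE. Qed.

(* The orders of the group S of the header as the A_1-subgroup varies; w has I_min = m + 3 - k and
   I_max = m + 3 - l, where 2 ^ k and 2 ^ l are the largest and the smallest entry. *)
Lemma gen2_ordersE :
  ((gen2_orders (mx_vecs mxP1) = [:: 4; 8]) *
   (gen2_orders (mx_vecs mxP2) = [:: 4; 8]) *
   (gen2_orders (mx_vecs mxP3) = [:: 4; 8]) *
   (gen2_orders (mx_vecs mxP4) = [:: 4; 8]) *
   (gen2_orders (mx_vecs mxQ1) = [:: 2; 4; 8]) *
   (gen2_orders (mx_vecs mxQ2) = [:: 2; 8]) *
   (gen2_orders (mx_vecs mxQ3) = [:: 4; 8]) *
   (gen2_orders (mx_vecs mxQ4) = [:: 4; 8]) *
   (gen2_orders (mx_vecs mxQ5) = [:: 2; 4; 8]) *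
   (gen2_orders (mx_vecs mxR1) = [:: 2; 4]) *
   (gen2_orders (mx_vecs mxR2) = [:: 2; 4]) *
   (gen2_orders (mx_vecs mxR3) = [:: 2]))%type.
Proof.
have mx0E (k l : 'I_3) : mxR3 k l = 0%R by rewrite mxE.
by do !split; rewrite /mx_vecs ?mx0E ?mx_addE ?mx_unitE; vm_compute.
Qed.

(** * From a characteristic matrix to the indices of the subgroups *)

Section CharMatrix.
Context {gT : finGroupType} {G : {group gT}} {m : nat} {a : 'I_3 -> gT} {w : 'M['F_2]_3}.
Hypotheses (G_2group : 2.-group G) (G_gen3 : 'm(G) = 3)
  (Phi_central : 'Phi(G) \subset 'Z(G)) (G'_abelem : 2.-abelem G^`(1))
  (G'_card : #|G^`(1)| = 8) (m_ge2 : (2 <= m)%N)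
  (w_char : char_matrix G (fun=> m) a w).

Lemma char_matrix_gen g : g \in G -> exists i j k h,
  h \in G^`(1) /\ g = a 0%R ^+ i * a 1%R ^+ j * a 2%R ^+ k * h.
Proof.
case: w_char => aG defG _ _ gG; have nG'G := subsetP (normal_norm (der_normal 1 G)).
have [[K H defK _] _ _ _] := dprodP defG; rewrite defK in defG.
have : coset G^`(1) g \in G / G^`(1) by rewrite mem_quotient.
case/(mem_dprod defG) => s [t [sK /cycleP[k tE] gE _]].
case/(mem_dprod defK): sK => u [v [/cycleP[i uE] /cycleP[j vE] sE _]].
exists i, j, k, ((a 0%R ^+ i * a 1%R ^+ j * a 2%R ^+ k)^-1 * g).
have pG : a 0%R ^+ i * a 1%R ^+ j * a 2%R ^+ k \in G by rewrite !groupM ?groupX ?aG.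
split; last by rewrite mulKVg.
apply: coset_idr; first by rewrite nG'G ?groupM ?groupV.
rewrite morphM ?nG'G ?groupV //= gE morphV ?nG'G //=.
have -> : coset G^`(1) (a 0%R ^+ i * a 1%R ^+ j * a 2%R ^+ k) = s * t.
  by rewrite !morphM ?nG'G ?groupM ?groupX ?aG //= !morphX ?nG'G ?aG //= sE uE vE tE.
by rewrite mulVg.
Qed.

Lemma card_der_quotient : #|G / G^`(1)| = (2 ^ (3 * m))%N.
Proof.
case: w_char => aG defG oa _.
have [[K H defK _] _ _ _] := dprodP defG.
rewrite -(dprod_card defG) defK -(dprod_card defK) -!orderE !oa -!expnD.
by congr (2 ^ _)%N; ring.
Qed.

Let W := mx_vecs w.

Lemma der_central_Phi : G^`(1) \subset 'Z(G).
Proof. by apply: subset_trans Phi_central; rewrite (Phi_joing G_2group) joing_subl. Qed.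

Lemma char_matrix_pow :
  [/\ a 0%R ^+ (2 ^ m) = der_vec (a 0%R) (a 1%R) (a 2%R) W.1.1,
      a 1%R ^+ (2 ^ m) = der_vec (a 0%R) (a 1%R) (a 2%R) W.1.2
    & a 2%R ^+ (2 ^ m) = der_vec (a 0%R) (a 1%R) (a 2%R) W.2].
Proof. by case: w_char => _ _ _ aw; rewrite !aw !F2_nat. Qed.

Local Notation coord := (has_coord (G := G) (a 0%R) (a 1%R) (a 2%R)).

Lemma gen2_A1_index b c u v :
  coord b u -> coord c v -> vec3_cross u v != (false, false, false) ->
  A1_subgroup G <<[set b; c]>>%G
  /\ (#|G : <<[set b; c]>>| * gen2_order W u v = 2 ^ (m + 3))%N.
Proof.
have [aG _ _ _] := w_char; have [pow0 pow1 pow2] := char_matrix_pow.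
have cG' := der_central_Phi => bu cv uv.
have bG := has_coord_mem (aG 0%R) (aG 1%R) (aG 2%R) bu.
have cG := has_coord_mem (aG 0%R) (aG 1%R) (aG 2%R) cv.
have nbc : [~ b, c] != 1.
  by rewrite (comm_neq1 cG' G'_abelem G'_card (aG 0%R) (aG 1%R) (aG 2%R) char_matrix_gen bu cv).
have G'_exp g : g \in G -> g ^+ (2 ^ m) \in G^`(1).
  case/(has_coord_ex char_matrix_gen) => t gt.
  rewrite (pow_vec cG' G'_abelem m_ge2 (aG 0%R) (aG 1%R) (aG 2%R) pow0 pow1 pow2 gt).
  exact: der_vec_der.
split.
  split; first by rewrite gen_subG subUset !sub1set bG.
  exact: (gen2_min_nonabelian G_2group Phi_central bG cG nbc).
rewrite -(index_gen2 G_2group Phi_central G_gen3 G'_exp card_der_quotient G'_card bG cG nbc).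
congr (_ * _)%N; symmetry.
exact: (card_gen2_order cG' G'_abelem G'_card m_ge2 (aG 0%R) (aG 1%R) (aG 2%R)
          char_matrix_gen pow0 pow1 pow2 bu cv).
Qed.

(** Together with the converse [order_A1], this matches the indices that occur with the entries of
    the computed list. *)
Lemma A1_order (H : {group gT}) : A1_subgroup G H ->
  exists2 r, r \in gen2_orders W & (#|G : H| * r = 2 ^ (m + 3))%N.
Proof.
have [aG _ _ _] := w_char; case=> sHG /A1_gen2[b [c [bH cH nbc ->]]].
have [u bu] := has_coord_ex char_matrix_gen (subsetP sHG b bH).
have [v cv] := has_coord_ex char_matrix_gen (subsetP sHG c cH).
rewrite (comm_neq1 der_central_Phi G'_abelem G'_card (aG 0%R) (aG 1%R) (aG 2%R)
           char_matrix_gen bu cv) in nbc.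
have [_ eH] := gen2_A1_index bu cv nbc; exists (gen2_order W u v) => //.
by apply/gen2_ordersP; exists u, v.
Qed.

Lemma order_A1 r : r \in gen2_orders W ->
  exists2 H : {group gT}, A1_subgroup G H & (#|G : H| * r = 2 ^ (m + 3))%N.
Proof.
case/gen2_ordersP=> [[[u1 u2] u3] [[[v1 v2] v3] [uv ->]]].
(* Each exponent vector is realised by the corresponding product of the [a i]. *)
have cu := has_coord_vec (G := G) (a 0%R) (a 1%R) (a 2%R).
have [A1H eH] := gen2_A1_index (cu u1 u2 u3) (cu v1 v2 v3) uv.
by eexists; first exact: A1H.
Qed.

(** Index and order have constant product [2 ^ (m + 3)], so the least index belongs to the greatest
    entry. The conclusion is boolean, so that it can be tested on an explicit list. *)
Lemma Imin_orders e : (e <= 3)%N -> is_Imin G (m + e) ->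
  ((2 ^ (3 - e))%N \in gen2_orders W) && all (leq^~ (2 ^ (3 - e))%N) (gen2_orders W).
Proof.
move=> e3 [[H A1H iH] minH].
have pe : (2 ^ (m + 3) = 2 ^ (m + e) * 2 ^ (3 - e))%N by rewrite -expnD -addnA subnKC.
have p0 : (0 < 2 ^ (m + e))%N by rewrite expn_gt0.
apply/andP; split.
  have [r rW] := A1_order A1H; rewrite iH pe => /eqP.
  by rewrite eqn_pmul2l // => /eqP <-.
apply/allP => r /order_A1[K A1K /= eK].
by rewrite -(leq_pmul2l p0) -pe -eK leq_mul2r minH ?orbT.
Qed.

Lemma Imax_orders e : (e <= 3)%N -> is_Imax G (m + e) ->
  ((2 ^ (3 - e))%N \in gen2_orders W) && all (leq (2 ^ (3 - e))%N) (gen2_orders W).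
Proof.
move=> e3 [[H A1H iH] maxH].
have pe : (2 ^ (m + 3) = 2 ^ (m + e) * 2 ^ (3 - e))%N by rewrite -expnD -addnA subnKC.
have p0 : (0 < 2 ^ (m + e))%N by rewrite expn_gt0.
apply/andP; split.
  have [r rW] := A1_order A1H; rewrite iH pe => /eqP.
  by rewrite eqn_pmul2l // => /eqP <-.
apply/allP => r /order_A1[K A1K /= eK].
by rewrite -(leq_pmul2l p0) -pe -eK leq_mul2r maxH ?orbT.
Qed.

End CharMatrix.

Unset Implicit Arguments.

Theorem theorem7p5 (gT : finGroupType) (G : {group gT}) (m : nat)
    (a : 'I_3 -> gT) (w : 'M['F_2]_3)
    (G_2group : 2.-group G)
    (G_gen3 : 'm(G) = 3)
    (Phi_central : 'Phi(G) \subset 'Z(G))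
    (G'_abelem : 2.-abelem G^`(1))
    (G'_card : #|G^`(1)| = 8)
    (m_ge2 : (2 <= m)%N)
    (GG'_type : abelian_type (G / G^`(1)) = [:: 2 ^ m; 2 ^ m; 2 ^ m]%N)
    (w_char : char_matrix G (fun=> m) a w)
    (w_list : w \in [:: mxP1; mxP2; mxP3; mxP4; mxQ1; mxQ2; mxQ3; mxQ4; mxQ5; mxR1; mxR2; mxR3]) :
  [/\ is_Imin G m -> w \in [:: mxP1; mxP2; mxP3; mxP4; mxQ1; mxQ2; mxQ3; mxQ4; mxQ5],
      is_Imin G m.+1 -> w \in [:: mxR1; mxR2],
      is_Imin G m.+2 -> w = mxR3,
      is_Imax G m.+2 -> w \in [:: mxQ1; mxQ2; mxQ5; mxR1; mxR2; mxR3]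
    & is_Imax G m.+1 -> w \in [:: mxP1; mxP2; mxP3; mxP4; mxQ3; mxQ4]].
Proof.
have I e := Imin_orders (e := e) G_2group G_gen3 Phi_central G'_abelem G'_card m_ge2 w_char.
have J e := Imax_orders (e := e) G_2group G_gen3 Phi_central G'_abelem G'_card m_ge2 w_char.
(* The greatest entry would be 8, 4 or 2 respectively; for [J1] and [J2] the least entry would be 4
   or 2. *)
have I0 := I 0%N isT; have I1 := I 1%N isT; have I2 := I 2%N isT.
have J1 := J 1%N isT; have J2 := J 2%N isT.
rewrite addn0 in I0; rewrite addn1 in I1 J1; rewrite addn2 in I2 J2.
rewrite !in_cons in_nil orbF in w_list.
move: w_list I0 I1 I2 J1 J2; do 11?case/predU1P; last move/eqP;
  move=> -> I0 I1 I2 J1 J2; rewrite gen2_ordersE in I0 I1 I2 J1 J2; split.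
(* If the order condition fails for the matrix at hand, the goal holds vacuously. Otherwise [try]
   restores it, and the matrix is one of those claimed. *)
all: try (first [move/I0 | move/I1 | move/I2 | move/J2 | move/J1] => absurd;
  exfalso; move: absurd; by rewrite !inE).
all: by move=> _; rewrite ?in_cons ?eqxx ?orbT.
Qed.
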